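(* Let $S=\langle a_1<\dots<a_p\rangle$ be a numerical semigroup and let $\delta=\operatorname{lcm}(a_1,a_p)$. Then the function $\Delta\nu:\mathbb{N}\to\mathcal{P}(\mathbb{N})$, $n\mapsto\Delta\nu(n)$, is almost periodic (that is, eventually periodic) with period $\delta$: there is a bound $n_0$ such that $\Delta\nu(n+\delta)=\Delta\nu(n)$ for every integer $n\ge n_0$. Moreover, when $p\ge 3$, the number $N_0$ (defined explicitly in the context) is such a bound: $\Delta\nu(n+\delta)=\Delta\nu(n)$ for every integer $n\geq N_0$.
   Context: $\mathbb{N}$ is the set of nonnegative integers. $S=\langle a_1<\dots<a_p\rangle=\{\sum_{i=1}^p\lambda_i a_i\mid \lambda_i\in\mathbb{N}\}$ is a primitive numerical semigroup: the $a_i$ are positive integers with $a_1<\dots<a_p$ and $\gcd(a_1,\dots,a_p)=1$. For $s\in S$, the set of factorizations is $\mathsf{Z}(s)=\{(x_1,\dots,x_p)\in\mathbb{N}^p\mid a_1x_1+\dots+a_px_p=s\}$, the length of $x=(x_1,\dots,x_p)$ is $\mathtt{L}(x)=x_1+\dots+x_p$, and the set of lengths of $s$ is $\mathcal{L}(s)=\{\mathtt{L}(x)\mid x\in\mathsf{Z}(s)\}$. For $n\in\mathbb{N}$ let $\mathsf{W}(n)=\{s\in S\mid \exists x\in\mathsf{Z}(s)\text{ with }\mathtt{L}(x)=n\}$ and $\nu(n)=\bigcup_{s\in\mathsf{W}(n)}\mathcal{L}(s)$ (a finite set). For a finite set of integers $A=\{l_1<l_2<\dots<l_r\}$ write $\Delta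 A=\{l_2-l_1,\dots,l_r-l_{r-1}\}$ (the set of consecutive differences, empty if $r\le 1$). Put $\Delta\nu(n)=\Delta(\nu(n))$. Constants (for $p\ge 3$). Let $d=\gcd\{a_{i+1}-a_i\mid i=1,\dots,p-1\}$. For $i=2,\dots,p-1$ let $g_i=\gcd(a_i-a_1,a_1-a_p,a_p-a_i)$ and $$S_i=-\frac{a_2\left(a_1 d\, g_i+(p-2)(a_1-a_i)(a_1-a_p)\right)}{(a_1-a_2)\,g_i},\qquad S'_i=\frac{a_{p-1}\left((p-2)(a_1-a_p)(a_p-a_i)-d\,a_p\, g_i\right)}{(a_{p-1}-a_p)\,g_i}.$$ Let $N_S=\lceil\max(\{S_i\mid i=2,\dots,p-1\}\cup\{S'_i\mid i=2,\dots,p-1\})\rceil$. Let $$C_1=\frac{(a_p-a_{p-1})N_S}{a_{p-1}},\quad C_2=\frac{(a_1-a_2)N_S}{a_2},$$ $$C_3=\left(-\frac{a_p}{a_1}+\frac{a_p}{a_2}-\frac{a_p}{a_{p-1}}+1\right)N_S,\quad C_4=\left(\frac{a_1}{a_{p-1}}-\frac{a_1}{a_p}-\frac{a_1}{a_2}+1\right)N_S,$$ $\lambda_1=\max(C_1,C_4)$, $\lambda_2=-\min(C_2,C_3)$, and $$N_0=\max\left(\frac{N_S}{a_1},\frac{a_p-a_1+\lambda_1+\lambda_2}{a_p-a_1}\right).$$ *)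

(* Defs.v *)
From mathcomp Require Import all_boot all_order all_algebra.
From mathcomp Require Import boolp classical_sets.

Set Implicit Arguments.
Unset Strict Implicit.
Unset Printing Implicit Defensive.

Import Order.TTheory GRing.Theory Num.Theory.

Local Open Scope classical_set_scope.
Local Open Scope ring_scope.

Section Semigroup.
Local Open Scope nat_scope.
Variables (p : nat) (a : p.-tuple nat).

(* Generators are numbered from 1: [gen 1] is the first one, [gen p] the last
   one; the value of [gen] outside of 1, ..., p is irrelevant. *)
Definition gen (i : nat) : nat := nth 0 a i.-1.

Definition numsemigroup : set nat :=
  [set s | exists x : p.-tuple nat, s = \sum_(i < p) tnth x i * tnth a i].

Definition factorizations (s : nat) : set (p.-tuple nat) :=
  [set x | \sum_(i < p) tnth a i * tnth x i = s].

Definition flength (x : p.-tuple nat) : nat := \sum_(i < p) tnth x i.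

Definition lengths (s : nat) : set nat := flength @` factorizations s.

Definition W (n : nat) : set nat :=
  [set s | numsemigroup s /\
           exists2 x, factorizations s x & flength x = n].

Definition nu (n : nat) : set nat := \bigcup_(s in W n) lengths s.

End Semigroup.

(* Differences of consecutive elements of A. *)
Definition Delta (A : set nat) : set nat :=
  [set k | exists l l' : nat,
     [/\ A l, A l', (l < l')%N,
         forall m, A m -> ~~ (l < m < l')%N & k = (l' - l)%N]].

Definition Delta_nu (p : nat) (a : p.-tuple nat) (n : nat) : set nat :=
  Delta (nu a n).

(* The constants below are only meaningful for p >= 3. *)
Section Constants.
Variables (p : nat) (a : p.-tuple nat).

Local Notation aq i := (gen a i)%:R.
Local Notation az i := (gen a i)%:Z.

Definition dgcd : int := \big[gcdz/0]_(1 <= i < p) (az i.+1 - az i).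

Definition g (i : nat) : int :=
  gcdz (gcdz (az i - az 1) (az 1 - az p)) (az p - az i).

Local Notation d := dgcd%:~R.
Local Notation gq i := (g i)%:~R.

Definition S_ (i : nat) : rat :=
  - (aq 2 * (aq 1 * d * gq i + (p%:R - 2) * (aq 1 - aq i) * (aq 1 - aq p)))
  / ((aq 1 - aq 2) * gq i).

Definition S'_ (i : nat) : rat :=
  aq p.-1 * ((p%:R - 2) * (aq 1 - aq p) * (aq p - aq i) - d * aq p * gq i)
  / ((aq p.-1 - aq p) * gq i).

(* Using the first term of each nonempty family as the initial value makes
   these the plain maxima of the families. *)
Definition N_S : int :=
  Num.ceil (Num.max (\big[Num.max/S_ 2]_(2 <= i < p) S_ i)
                    (\big[Num.max/S'_ 2]_(2 <= i < p) S'_ i)).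

Local Notation NS := N_S%:~R.

Definition C1 : rat := (aq p - aq p.-1) * NS / aq p.-1.
Definition C2 : rat := (aq 1 - aq 2) * NS / aq 2.
Definition C3 : rat :=
  (- (aq p / aq 1) + aq p / aq 2 - aq p / aq p.-1 + 1) * NS.
Definition C4 : rat :=
  (aq 1 / aq p.-1 - aq 1 / aq p - aq 1 / aq 2 + 1) * NS.

Definition lambda1 : rat := Num.max C1 C4.
Definition lambda2 : rat := - Num.min C2 C3.

Definition N0 : rat :=
  Num.max (NS / aq 1) ((aq p - aq 1 + lambda1 + lambda2) / (aq p - aq 1)).

End Constants.

(* Main.v *)
(** Put e_i = a_i - a_1, f_i = a_p - a_i, D = a_p - a_1, and let T be the monoid
    generated by the e_i and f_i. Comparing a factorization of length n, written
    n a_1 + sum x_i e_i, with one of length m, written m a_p - sum y_i f_i, shows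
    that m in nu(n) forces m a_p - n a_1 and n a_p - m a_1 to lie in T. Modulo D
    the coefficients of an element of T can be reduced below
    q_i = D / gcd(e_i, D), so for n large the converse holds as well: the first
    condition suffices when m <= n, the second when m >= n. Moreover T contains
    every large multiple of d = gcd(e_i). The two conditions are invariant under
    n -> n + delta combined with m -> m + delta a_1 / a_p, respectively
    m -> m + delta a_p / a_1. Hence nu(n + delta) arises from nu(n) by translating
    its parts below and above n and filling the space between them with an
    arithmetic progression of difference d, a difference that already occurs in
    nu(n) between n and n + d. Of the two terms of N_0, only N_S / a_1 matters. *)

Require Import Defs.
From mathcomp Require Import all_boot all_order all_algebra.
From mathcomp Require Import boolp classical_sets.
From mathcomp Require Import zify ring.

Import Order.TTheory GRing.Theory Num.Theory.

Local Open Scope ring_scope.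

(** * Bezout relations, and consecutive differences of a stretched set *)

Lemma big_gcdn_Bezout (I : finType) (F : I -> nat) :
  exists z : I -> int, (\big[gcdn/0%N]_i F i)%:Z = \sum_i z i * (F i)%:Z.
Proof.
pose comb (h : nat) := exists z : I -> int, h%:Z = \sum_i z i * (F i)%:Z.
(* Integer combinations of the [F i] include 0 and each [F i], and are closed under gcd by the
   two-term Bezout identity. *)
apply: (big_ind comb) => [|h1 h2 [z1 h1E] [z2 h2E]|i _].
- by exists (fun=> 0); rewrite big1 // => i _; rewrite mul0r.
- have [u [v uvE]] := Bezoutz h1%:Z h2%:Z.
  exists (fun i => u * z1 i + v * z2 i).
  transitivity (u * h1%:Z + v * h2%:Z) => //.
  rewrite h1E h2E !mulr_sumr -big_split; apply: eq_bigr => i _ /=; ring.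
- exists (fun j => (j == i)%:Z); rewrite (bigD1 i) //= eqxx mul1r big1 ?addr0 //.
  by move=> j /negPf ->; rewrite mul0r.
Qed.

(* [A'] is [A] cut at [n], with an arithmetic progression of difference [d]
   inserted between the two translated halves. *)
Lemma Delta_stretch (A A' : set nat) (n s t d : nat) :
  (0 < d)%N -> (s <= t)%N -> (d %| t - s)%N ->
  (forall m, (m <= n)%N -> A m <-> A' (m + s)%N) ->
  (forall m, (n <= m)%N -> A m <-> A' (m + t)%N) ->
  (forall m, (n + s <= m <= n + t)%N -> A' m <-> (d %| m - (n + s))%N) ->
  (forall m, A' m -> (s <= m)%N) ->
  (forall m, (n <= m)%N -> A m -> (d %| m - n)%N) ->
  A n -> A (n + d)%N ->
  Delta A' = Delta A.
Proof.
move=> d_gt0 le_st dvd_d lowE highE midE low_bound congA An And.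
apply/predeqP => k; split=> [] [l [l' [Al Al' ltll' cons ->]]].
- have A's : A' (n + s)%N by apply/lowE.
  have A't : A' (n + t)%N by apply/highE.
  (* As [n + s] and [n + t] lie in [A'], no consecutive pair straddles either: it sits below, above
     or inside the inserted progression. *)
  have [lel's|lts] := leqP l' (n + s).
    have les := low_bound _ Al; have les' := low_bound _ Al'.
    exists (l - s)%N, (l' - s)%N; split; last by lia.
    + by apply/lowE; rewrite ?subnK //; lia.
    + by apply/lowE; rewrite ?subnK //; lia.
    + by lia.
    + move=> m Am; apply/negP => mP.
      have /cons /negP[] : A' (m + s)%N by apply/lowE => //; lia.
      lia.
  have [letl|ltt] := leqP (n + t) l.
    exists (l - t)%N, (l' - t)%N; split; last by lia.
    + by apply/highE; rewrite ?subnK //; lia.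
    + by apply/highE; rewrite ?subnK //; lia.
    + by lia.
    + move=> m Am; apply/negP => mP.
      have /cons /negP[] : A' (m + t)%N by apply/highE => //; lia.
      lia.
  have lesl : (n + s <= l)%N by have := cons _ A's; lia.
  have lel't : (l' <= n + t)%N by have := cons _ A't; lia.
  have /dvdnP[u uE] : (d %| l - (n + s))%N by apply/midE => //; lia.
  have /dvdnP[v vE] : (d %| l' - (n + s))%N by apply/midE => //; lia.
  have /dvdnP[w wE] := dvd_d.
  have ltuv : (u < v)%N by rewrite -(ltn_pmul2r d_gt0); lia.
  have ltuw : (u < w)%N by rewrite -(ltn_pmul2r d_gt0); lia.
  have leuv : (u * d + d <= v * d)%N by rewrite addnC -mulSn leq_pmul2r.
  have leuw : (u * d + d <= w * d)%N by rewrite addnC -mulSn leq_pmul2r.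
  have A'ld : A' (l + d)%N.
    apply/midE; first by lia.
    have -> : (l + d - (n + s) = u.+1 * d)%N by rewrite mulSn; lia.
    exact: dvdn_mull.
  have l'E : l' = (l + d)%N by have := cons _ A'ld; lia.
  (* Inside the progression the difference is [d]; [A] realizes it at [n] and [n + d], with nothing
     between by [congA]. *)
  exists n, (n + d)%N; split=> //; try by lia.
  move=> m Am; apply/negP => /andP[ltnm ltmnd].
  have /dvdnP[x xE] := congA m (ltnW ltnm) Am.
  by case: x xE => [|x]; rewrite ?mulSn; lia.
- have [lel'n|ltnl'] := leqP l' n.
    exists (l + s)%N, (l' + s)%N; split; last by lia.
    + by apply/lowE => //; lia.
    + by apply/lowE.
    + by lia.
    + move=> m A'm; apply/negP => mP.
      have /cons /negP[] : A (m - s)%N by apply/lowE; rewrite ?subnK //; lia.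
      lia.
  have lenl : (n <= l)%N by have := cons _ An; lia.
  exists (l + t)%N, (l' + t)%N; split; last by lia.
  + by apply/highE.
  + by apply/highE => //; lia.
  + by lia.
  + move=> m A'm; apply/negP => mP.
    have /cons /negP[] : A (m - t)%N by apply/highE; rewrite ?subnK //; lia.
    lia.
Qed.

(** * Pairs of factorizations with equal value and prescribed lengths *)

Section TwoFactorizations.
Local Open Scope nat_scope.
Variables (p : nat) (a : 'I_p.+2 -> nat).
Hypothesis a_min : forall i, a ord0 <= a i.
Hypothesis a_max : forall i, a i <= a ord_max.
Hypothesis a_lt : a ord0 < a ord_max.

Local Notation amin := (a ord0).
Local Notation amax := (a ord_max).

(** Membership of m in nu(n) with the semigroup element eliminated, a form symmetric in [n] and
    [m]. *)
Definition common_value (n m : nat) := exists x y : 'I_p.+2 -> nat,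
  [/\ \sum_i x i = n, \sum_i y i = m & \sum_i x i * a i = \sum_i y i * a i].

(** [above], [below], [width], [gap] are e_i, f_i, D, d; further down, [per] is q_i and [in_gaps] is
    membership in T. *)
Definition above i := a i - amin.
Definition below i := amax - a i.
Definition width := amax - amin.
Definition gap := \big[gcdn/0]_i above i.

(* Least number of copies of [above i], or of [below i], that can be traded for
   copies of [width]. *)
Definition per i := width %/ gcdn (above i) width.

Definition in_gaps (t : nat) := exists x y : 'I_p.+2 -> nat,
  t = \sum_i x i * above i + \sum_i y i * below i.

Lemma width_gt0 : 0 < width.
Proof. by rewrite subn_gt0. Qed.

Lemma above_below i : above i + below i = width.
Proof. by rewrite addnC /above /below addnBA // subnK. Qed.

Lemma per_gt0 i : 0 < per i.
Proof.
by rewrite divn_gt0 ?gcdn_gt0 ?width_gt0 ?orbT // dvdn_leq ?width_gt0 ?dvdn_gcdr.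
Qed.

Lemma per_above i : width %| per i * above i.
Proof. by rewrite divn_mulAC ?dvdn_gcdr // -muln_divA ?dvdn_gcdl // dvdn_mulr. Qed.

Lemma per_below i : width %| per i * below i.
Proof.
by rewrite -(dvdn_addr _ (per_above i)) -mulnDr above_below dvdn_mull.
Qed.

Lemma per_min : per ord0 = 1.
Proof. by rewrite /per /above subnn gcd0n divnn width_gt0. Qed.

Lemma per_max : per ord_max = 1.
Proof. by rewrite /per /above gcdnn divnn width_gt0. Qed.

Lemma sum_lt_per (x : 'I_p.+2 -> nat) :
  (forall i, x i < per i) -> \sum_i x i <= \sum_i (per i).-1.
Proof. by move=> xq; apply: leq_sum => i _; rewrite -ltnS prednK ?per_gt0. Qed.

Lemma common_value_sym n m : common_value n m -> common_value m n.
Proof. by case=> x [y [xn ym xy]]; exists y, x. Qed.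

Lemma sum_above (x : 'I_p.+2 -> nat) :
  \sum_i x i * a i = \sum_i x i * above i + (\sum_i x i) * amin.
Proof.
by rewrite big_distrl -big_split; apply: eq_bigr => i _ /=;
  rewrite -mulnDr subnK.
Qed.

Lemma sum_below (x : 'I_p.+2 -> nat) :
  \sum_i x i * a i + \sum_i x i * below i = (\sum_i x i) * amax.
Proof.
by rewrite big_distrl -big_split; apply: eq_bigr => i _ /=;
  rewrite -mulnDr subnKC.
Qed.

Lemma common_value_gaps n m :
  common_value n m -> exists2 t, in_gaps t & m * amax = n * amin + t.
Proof.
case=> x [y [xn ym xy]].
exists (\sum_i x i * above i + \sum_i y i * below i); first by exists x, y.
by rewrite -ym -sum_below -xy sum_above xn; lia.
Qed.

Lemma in_gaps_reduced t : in_gaps t -> exists k (x y : 'I_p.+2 -> nat),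
  [/\ t = k * width + (\sum_i x i * above i + \sum_i y i * below i),
      forall i, x i < per i & forall i, y i < per i].
Proof.
(* Each block of [per i] copies is a multiple of [width]; the quotients collect into [k] and the
   remainders stay. *)
have red (u : 'I_p.+2 -> nat) (F : 'I_p.+2 -> nat) :
    (forall i, width %| per i * F i) ->
    exists k, \sum_i u i * F i = k * width + \sum_i (u i %% per i) * F i.
  move=> dvdF; exists (\sum_i u i %/ per i * (per i * F i %/ width)).
  rewrite big_distrl -big_split; apply: eq_bigr => i _ /=.
  by rewrite -mulnA divnK // mulnA -mulnDl -divn_eq.
case=> x [y ->].
have [k1 ->] := red x _ per_above; have [k2 ->] := red y _ per_below.
exists (k1 + k2), (fun i => x i %% per i), (fun i => y i %% per i).
split=> [|i|i]; rewrite ?ltn_pmod ?per_gt0 //.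
by rewrite mulnDl; lia.
Qed.

(** Adds [k] copies of the first generator and [l] of the last; [F] constant 1 gives lengths,
    [F = a] gives values. *)
Lemma sum_pad (x : 'I_p.+2 -> nat) (F : 'I_p.+2 -> nat) (k l : nat) :
  \sum_i (x i + (i == ord0) * k + (i == ord_max) * l) * F i =
  \sum_i x i * F i + k * F ord0 + l * F ord_max.
Proof.
have pick j c : \sum_i (i == j) * c * F i = c * F j.
  rewrite (bigD1 j) //= eqxx mul1n big1 ?addn0 // => i /negPf ->.
  by rewrite !mul0n.
by rewrite -!pick -!big_split; apply: eq_bigr => i _ /=; rewrite !mulnDl.
Qed.

(** One copy of [width] is absorbed by replacing a_1 with a_p in the factorization of length n, or
    a_p with a_1 in that of length m. So [k] splits as [k1 + k2], and the free places are filled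
    with a_1 on the first side and a_p on the second. The last hypothesis guarantees room for all
    [k] replacements. *)
Lemma common_value_reduced n m k (x y : 'I_p.+2 -> nat) :
  (forall i, x i < per i) -> (forall i, y i < per i) ->
  m * amax = n * amin
    + (k * width + (\sum_i x i * above i + \sum_i y i * below i)) ->
  \sum_i x i <= n -> \sum_i y i <= m ->
  m * amin + (\sum_i (per i).-1) * width <= n * amax ->
  common_value n m.
Proof.
move=> xq yq mE xn ym bound.
have Q i : x i * below i + y i * above i <= (per i).-1 * width.
  rewrite -(above_below i) mulnDr addnC leq_add // leq_mul2r.
    by apply/orP; right; move: (yq i); lia.
  by apply/orP; right; move: (xq i); lia.
have sQ : \sum_i x i * below i + \sum_i y i * above i
    <= (\sum_i (per i).-1) * width.
  by rewrite -big_split big_distrl; apply: leq_sum => i _.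
have widthE : width + amin = amax by rewrite subnK.
have xE : \sum_i x i * above i + \sum_i x i * below i = (\sum_i x i) * width.
  rewrite big_distrl -big_split; apply: eq_bigr => i _ /=.
  by rewrite -mulnDr above_below.
have yE : \sum_i y i * above i + \sum_i y i * below i = (\sum_i y i) * width.
  rewrite big_distrl -big_split; apply: eq_bigr => i _ /=.
  by rewrite -mulnDr above_below.
(* Times [width], the left side becomes m a_p - n a_1 + sum x_i f_i + sum y_i e_i by [mE]; then [sQ]
   and [bound] apply. *)
have kle : k + \sum_i x i + \sum_i y i <= n + m.
  rewrite -(leq_pmul2r width_gt0) !mulnDl.
  move: mE bound; rewrite -widthE !mulnDr; lia.
have [k1 [k2 [kE k1n k2m]]] : exists k1 k2,
    [/\ k = k1 + k2, k1 <= n - \sum_i x i & k2 <= m - \sum_i y i].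
  exists (minn k (n - \sum_i x i)), (k - (n - \sum_i x i)).
  by split; lia.
exists (fun i => x i + (i == ord0) * (n - \sum_i x i - k1) + (i == ord_max) * k1).
exists (fun i => y i + (i == ord0) * k2 + (i == ord_max) * (m - \sum_i y i - k2)).
have one (z : 'I_p.+2 -> nat) : \sum_i z i = \sum_i z i * 1.
  by apply: eq_bigr => i _; rewrite muln1.
split.
- by rewrite one sum_pad -one; lia.
- by rewrite one sum_pad -one; lia.
rewrite !sum_pad.
have sx := sum_above x; have sy := sum_below y.
have nE : n = \sum_i x i + k1 + (n - \sum_i x i - k1) by lia.
have mE' : m = \sum_i y i + k2 + (m - \sum_i y i - k2) by lia.
move: (n - _ - _) (m - _ - _) nE mE' => n' m' nE mE'.
move: mE; rewrite kE nE mE'; move: sx sy; rewrite -widthE !mulnDr !mulnDl.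
lia.
Qed.

(** * Divisibility by the gap, and large elements of the monoid T *)

Lemma gap_dvd_above i : gap %| above i.
Proof. by rewrite /gap (bigD1 i) //= dvdn_gcdl. Qed.

Lemma gap_dvd_width : gap %| width.
Proof. exact: gap_dvd_above. Qed.

Lemma gap_gt0 : 0 < gap.
Proof. exact: dvdn_gt0 width_gt0 gap_dvd_width. Qed.

Lemma gap_dvd_below i : gap %| below i.
Proof.
by rewrite -(dvdn_addr _ (gap_dvd_above i)) above_below gap_dvd_width.
Qed.

Lemma in_gaps_dvd t : in_gaps t -> gap %| t.
Proof.
case=> x [y ->]; apply: dvdn_add; apply: dvdn_sum => i _; apply: dvdn_mull.
  exact: gap_dvd_above.
exact: gap_dvd_below.
Qed.

(** Bezout writes t as an integer combination of the e_i. Reducing the coefficients modulo q_i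
    leaves an integer multiple K of D; the lower bound on t forces K >= 0, and K copies of e_p = D
    complete the representation. *)
Lemma in_gaps_large t :
  gap %| t -> \sum_i (per i).-1 * above i <= t -> in_gaps t.
Proof.
move=> /dvdnP[c tE] le_t.
have [z zE] := big_gcdn_Bezout _ above.
pose w i := (c%:Z * z i)%R.
pose x i := `|(w i %% (per i)%:Z)%Z|.
have xE i : (x i)%:Z = (w i %% (per i)%:Z)%Z.
  by rewrite gez0_abs // modz_ge0 // lt0n_neq0 ?per_gt0.
have x_lt i : x i < per i.
  by rewrite -ltz_nat xE ltz_pmod // ltz_nat per_gt0.
pose K := (\sum_i (w i %/ (per i)%:Z)%Z * (per i * above i %/ width)%:Z)%R.
have KE : (t%:Z = K * width%:Z + (\sum_i x i * above i)%:Z)%R.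
  rewrite tE PoszM zE mulr_sumr mulr_suml.
  rewrite (big_morph Posz PoszD (erefl _)) -big_split; apply: eq_bigr => i _ /=.
  rewrite -mulrA -PoszM divnK ?per_above // PoszM mulrA PoszM xE mulrA -mulrDl.
  by rewrite -divz_eq.
have x_le : \sum_i x i * above i <= t.
  apply: leq_trans le_t; apply: leq_sum => i _; rewrite leq_mul2r.
  by apply/orP; right; move: (x_lt i); lia.
have K_ge0 : (0 <= K)%R.
  rewrite -(pmulr_lge0 (x := width%:Z)) ?ltz_nat ?width_gt0 //.
  by move: KE x_le; lia.
exists (fun i => x i + (i == ord0) * 0 + (i == ord_max) * `|K|), (fun=> 0).
have -> : \sum_i 0 * below i = 0 by rewrite big1.
rewrite sum_pad; move: KE.
rewrite -{1}(gez0_abs K_ge0) -PoszM -PoszD => -[->].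
rewrite (_ : above ord_max = width) //.
by rewrite mul0n !addn0 addnC.
Qed.

(* The consequences of [N_S <= n * a_1] on which periodicity rests; [b] stands
   for the second largest generator. *)
Definition large (b n : nat) :=
  [/\ \sum_i (per i).-1 <= n,
      \sum_i (per i).-1 * above i + gap * amin <= n * width &
      (\sum_i (per i).-1) * b <= n * amin].

Lemma large_mono b n n' : n <= n' -> large b n -> large b n'.
Proof.
move=> le_n [h1 h2 h3]; split.
- exact: leq_trans h1 le_n.
- by apply: leq_trans h2 _; rewrite leq_mul2r le_n orbT.
- by apply: leq_trans h3 _; rewrite leq_mul2r le_n orbT.
Qed.

(** * Exact description of the lengths when n is large *)

Variable b : nat.
Hypothesis a_gt0 : 0 < a ord0.
Hypothesis b_lt : b < amax.
Hypothesis b_max : forall i, i != ord_max -> a i <= b.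

(** The delicate requirement is sum y_i <= m. If m b >= n a_1, the third bound of [large] gives it;
    otherwise t = m a_p - n a_1 is below m (a_p - b), while each copy counted by y costs at least
    a_p - b, as y vanishes at the last index. *)
Lemma common_value_low n m t : large b n -> m <= n ->
  m * amax = n * amin + t -> in_gaps t -> common_value n m.
Proof.
move=> [h1 h2 h3] le_mn mE /in_gaps_reduced [k [x [y [tE xq yq]]]].
have bound : m * amin + (\sum_i (per i).-1) * width <= n * amax.
  have -> : amax = amin + width by rewrite subnKC // ltnW.
  by rewrite mulnDr leq_add // leq_mul2r ?le_mn ?h1 orbT.
apply: (common_value_reduced n m k x y) => //; first by rewrite -tE.
  exact: leq_trans (sum_lt_per _ xq) h1.
have [le_nm|lt_mn] := leqP (n * amin) (m * b).
  have b_gt0 : 0 < b by apply: leq_trans a_gt0 (b_max _ _).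
  rewrite -(leq_pmul2r b_gt0); apply: leq_trans le_nm; apply: leq_trans h3.
  by rewrite leq_mul2r sum_lt_per ?orbT.
have le_y : (\sum_i y i) * (amax - b) <= \sum_i y i * below i.
  rewrite big_distrl; apply: leq_sum => i _ /=.
  have [->|ni] := eqVneq i ord_max.
    by have := yq ord_max; rewrite per_max; case: (y _).
  by rewrite leq_mul2l leq_sub2l ?orbT ?b_max.
have bb : 0 < amax - b by rewrite subn_gt0.
rewrite -(leq_pmul2r bb); apply: leq_trans le_y _.
rewrite mulnBr; lia.
Qed.

(** Now n is the shorter length, so both coefficient sums fit by the first bound of [large]. *)
Lemma common_value_high n m t : large b n -> n <= m ->
  n * amax = m * amin + t -> in_gaps t -> common_value n m.
Proof.
move=> [h1 h2 h3] le_nm nE /in_gaps_reduced [k [x [y [tE xq yq]]]].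
apply: common_value_sym.
apply: (common_value_reduced m n k x y) => //; first by rewrite -tE.
- exact: leq_trans (sum_lt_per _ xq) (leq_trans h1 le_nm).
- exact: leq_trans (sum_lt_per _ yq) h1.
apply: leq_trans (_ : n * amax <= _); last by rewrite leq_mul2r le_nm orbT.
have -> : amax = amin + width by rewrite subnKC // ltnW.
by rewrite mulnDr leq_add // leq_mul2r h1 orbT.
Qed.

Lemma common_value_lowP n m : large b n -> m <= n ->
  common_value n m <-> exists2 t, in_gaps t & m * amax = n * amin + t.
Proof.
move=> n_large le_mn; split; first exact: common_value_gaps.
by case=> t tT mE; apply: common_value_low mE tT.
Qed.

Lemma common_value_highP n m : large b n -> n <= m ->
  common_value n m <-> exists2 t, in_gaps t & n * amax = m * amin + t.
Proof.
move=> n_large le_nm; split; first by move/common_value_sym/common_value_gaps.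
by case=> t tT mE; apply: common_value_high mE tT.
Qed.

(** * Periodicity of the difference sets *)

Hypothesis gap_coprime : coprime gap amax.

Lemma gap_coprime_min : coprime gap amin.
Proof.
have /dvdnP[w wE] := gap_dvd_width.
have : coprime gap (amin + width) by rewrite subnKC // ltnW.
by rewrite wE /coprime addnC gcdnMDl.
Qed.

(** The second bound of [large] puts n D beyond the threshold of [in_gaps_large], so only a
    congruence remains. *)
Lemma in_gapsP n t j : large b n -> t = n * width + j -> in_gaps t <-> gap %| j.
Proof.
move=> [_ h2 _] tE.
have dvdE : (gap %| t) = (gap %| j).
  by rewrite tE dvdn_addr // dvdn_mull // gap_dvd_width.
split; first by move/in_gaps_dvd; rewrite dvdE.
by move=> gj; apply: in_gaps_large; rewrite ?dvdE //; lia.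
Qed.

(** Here [u * amin] is the period delta; the translations are [v * amin] = delta a_1 / a_p and
    [u * amax] = delta a_p / a_1. *)
Lemma Delta_common_value_period n u v : large b n -> u * amin = v * amax ->
  Delta (common_value (n + u * amin)) = Delta (common_value n).
Proof.
move=> n_large uv.
have n'_large : large b (n + u * amin) by apply: large_mono n_large; lia.
have wE : amax = amin + width by rewrite subnKC // ltnW.
(* These two identities cancel the shifts in the equations for lengths below and above n. *)
have AC : u * amin * amin = v * amin * amax by rewrite uv mulnAC.
have AC' : u * amin * amax = u * amax * amin by rewrite mulnAC.
have gw c : gap %| c * width by rewrite dvdn_mull // gap_dvd_width.
have tsE : u * amax = v * amin + (u + v) * width.
  by move: uv; rewrite wE !mulnDr !mulnDl; lia.
have us : u * amin = v * amin + v * width by rewrite uv wE mulnDr.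
have ut : u * amax = u * amin + u * width by rewrite wE mulnDr.
apply: (Delta_stretch _ _ n (v * amin) (u * amax) gap).
- exact: gap_gt0.
- by rewrite tsE leq_addr.
- by rewrite tsE addKn.
- move=> m le_mn; rewrite !common_value_lowP //; last by lia.
  by split=> -[t tT mE]; exists t => //; move: mE; rewrite !mulnDl; lia.
- move=> m le_nm; rewrite !common_value_highP //; last by lia.
  by split=> -[t tT mE]; exists t => //; move: mE; rewrite !mulnDl; lia.
- move=> m /andP[lem gem].
  (* Up to n + delta, the offset j from n + v a_1 gives t = n D + j a_p, which lies in T exactly
     when the gap divides j. *)
  have [le_mn'|/ltnW le_n'm] := leqP m (n + u * amin).
    have [j mE] : exists j, m = n + v * amin + j by exists (m - (n + v * amin)); lia.
    have -> : m - (n + v * amin) = j by lia.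
    rewrite common_value_lowP // -(Gauss_dvdl _ gap_coprime).
    rewrite -(in_gapsP n (n * width + j * amax)) //.
    have E t : (m * amax = (n + u * amin) * amin + t) <-> t = n * width + j * amax.
      have nE : n * amax = n * amin + n * width by rewrite wE mulnDr.
      by rewrite mE !mulnDl; lia.
    by split=> [[t tT /E <-]|tT] //; exists (n * width + j * amax) => //; apply/E.
  (* Beyond it, j counts down from n + u a_p and t = n D + j a_1; the two ends differ by (u + v) D,
     a multiple of the gap. *)
  have [j mE] : exists j, n + u * amax = m + j by exists (n + u * amax - m); lia.
  have -> : (gap %| m - (n + v * amin)) = (gap %| j).
    have : gap %| m - (n + v * amin) + j.
      by have -> : m - (n + v * amin) + j = (u + v) * width by lia.
    by move=> gs; apply/idP/idP => gx; move: gs;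
      rewrite ?(dvdn_addr _ gx) ?(dvdn_addl _ gx).
  rewrite common_value_highP // -(Gauss_dvdl _ gap_coprime_min).
  rewrite -(in_gapsP n (n * width + j * amin)) //.
  have E t : (n + u * amin) * amax = m * amin + t <-> t = n * width + j * amin.
    have nE : n * amax = n * amin + n * width by rewrite wE mulnDr.
    have : (n + u * amax) * amin = (m + j) * amin by rewrite mE.
    by rewrite !mulnDl; lia.
  by split=> [[t tT /E <-]|tT] //; exists (n * width + j * amin) => //; apply/E.
- move=> m A'm; have [le_mn'|] := leqP m (n + u * amin); last by lia.
  have amax_gt0 : 0 < amax by apply: leq_trans a_gt0 (ltnW a_lt).
  have [t _] := common_value_gaps _ _ A'm.
  rewrite -(leq_pmul2r amax_gt0) => ->; rewrite mulnDl; lia.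
- move=> m le_nm /(common_value_highP _ _ n_large le_nm) [t tT].
  have [j ->] : exists j, m = n + j by exists (m - n); lia.
  rewrite wE mulnDr mulnDl -addnA => /addnI nE.
  rewrite addKn -(Gauss_dvdl _ gap_coprime_min) -(dvdn_addl _ (in_gaps_dvd _ tT)).
  by rewrite -nE.
- rewrite common_value_lowP //; exists (n * width); last by rewrite wE mulnDr.
  by apply/(in_gapsP n _ 0) => //; rewrite addn0.
(* The element of T needed for n + d is n D - d a_1; the term [gap * amin] in [large] keeps it above
   the threshold. *)
- have [_ h2 _] := n_large.
  rewrite common_value_highP ?leq_addr //; exists (n * width - gap * amin).
    apply: in_gaps_large; last by lia.
    by apply: dvdn_sub; rewrite ?gw // dvdn_mulr.
  by rewrite wE mulnDr mulnDl; lia.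
Qed.

End TwoFactorizations.

(** * Translation of the semigroup data, and an averaging inequality *)

Lemma nuE (p : nat) (a : p.+2.-tuple nat) (n : nat) :
  nu a n = common_value p (tnth a) n.
Proof.
apply/predeqP => m; split.
- case=> s [_ [x xs xn]] [y ys ym]; exists (tnth x), (tnth y); split=> //.
  transitivity s; [rewrite -xs | rewrite -ys];
    by apply: eq_bigr => i _; rewrite mulnC.
- case=> x [y [xn ym xy]].
  exists (\sum_i x i * tnth a i)%N;
    [split; [|exists (mktuple x)]|exists (mktuple y)].
  + by exists (mktuple x); apply: eq_bigr => i _; rewrite tnth_mktuple.
  + by apply: eq_bigr => i _; rewrite tnth_mktuple mulnC.
  + by rewrite -xn; apply: eq_bigr => i _; rewrite tnth_mktuple.
  + by rewrite xy; apply: eq_bigr => i _; rewrite tnth_mktuple mulnC.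
  + by rewrite -ym; apply: eq_bigr => i _; rewrite tnth_mktuple.
Qed.

Lemma gen_tnth (p : nat) (a : p.-tuple nat) (i : 'I_p) : gen a i.+1 = tnth a i.
Proof. by rewrite (tnth_nth 0%N). Qed.

(** A common divisor of a_p and all e_i divides a_1 = a_p - e_p, hence every a_i, hence 1. *)
Lemma gcdn_sub_coprime (p : nat) (a : 'I_p.+2 -> nat) :
  (forall i, a ord0 <= a i)%N -> (\big[gcdn/0]_i a i = 1)%N ->
  coprime (gap p a) (a ord_max).
Proof.
move=> a_min a_prim; rewrite /coprime -dvdn1 -a_prim.
have dvd_above i : (gcdn (gap p a) (a ord_max) %| above p a i)%N.
  exact: dvdn_trans (dvdn_gcdl _ _) (gap_dvd_above _ _ _).
have aE i : a i = (a ord0 + above p a i)%N by rewrite subnKC.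
have dvd0 : (gcdn (gap p a) (a ord_max) %| a ord0)%N.
  by rewrite -(dvdn_addl _ (dvd_above ord_max)) -aE dvdn_gcdr.
apply: (big_ind (fun h => gcdn (gap p a) (a ord_max) %| h)%N) => //.
  by move=> x y hx hy; rewrite dvdn_gcd hx.
by move=> i _; rewrite (aE i) dvdn_addr.
Qed.

(** Averages the inequalities at the k + 1 = p - 2 inner indices, the source of the factor p - 2 in
    S_i and S'_i. *)
Lemma sum_le_average (k c r M : nat) (F : 'I_k.+3 -> nat) :
  F ord0 = 0%N -> F ord_max = 0%N ->
  (forall i, c * (k.+1 * F i + r) <= M)%N -> (c * (\sum_i F i + r) <= M)%N.
Proof.
move=> F0 Fmax FM; rewrite -(leq_pmul2l (ltn0Sn k)).
have lift_max : lift ord0 ord_max = ord_max :> 'I_k.+3 by apply: val_inj.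
rewrite big_ord_recl big_ord_recr /= F0 lift_max Fmax add0n addn0.
rewrite -[X in (_ <= X * M)%N]card_ord -sum_nat_const.
rewrite mulnCA mulnDr big_distrr /= -[X in (X * r)%N]card_ord -sum_nat_const.
by rewrite -big_split big_distrr; apply: leq_sum => i _.
Qed.

(** * The explicit bound, for p = k + 3 generators *)

Section ExplicitBound.
Variables (k : nat) (a : k.+3.-tuple nat).
Hypothesis a_gt0 : forall i : 'I_k.+3, (0 < tnth a i)%N.
Hypothesis a_incr : forall i j : 'I_k.+3, (i < j)%N -> (tnth a i < tnth a j)%N.

Let a_mono (i j : 'I_k.+3) : (i <= j)%N -> (tnth a i <= tnth a j)%N.
Proof.
rewrite leq_eqVlt => /orP[/eqP/val_inj -> //|lt_ij]; exact: ltnW (a_incr _ _ lt_ij).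
Qed.

Let a_min i : (tnth a ord0 <= tnth a i)%N. Proof. exact: a_mono. Qed.

Let a_max i : (tnth a i <= tnth a ord_max)%N.
Proof. by apply: a_mono; rewrite -ltnS. Qed.

Let a_lt : (tnth a ord0 < tnth a ord_max)%N. Proof. exact: a_incr. Qed.

Local Notation e := (above k.+1 (tnth a)).
Local Notation f := (below k.+1 (tnth a)).
Local Notation D := (width k.+1 (tnth a)).
Local Notation q := (per k.+1 (tnth a)).
Local Notation i2 := (lift ord0 ord0 : 'I_k.+3).
Local Notation ip1 := (widen_ord (leqnSn k.+2) ord_max : 'I_k.+3).

Let genS (i : 'I_k.+3) : gen a i.+1 = tnth a i. Proof. exact: gen_tnth. Qed.
Let gen1 : gen a 1 = tnth a ord0. Proof. exact: (genS ord0). Qed.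
Let gen2 : gen a 2 = tnth a i2. Proof. exact: (genS i2). Qed.
Let genp : gen a k.+3 = tnth a ord_max. Proof. exact: (genS ord_max). Qed.
Let genp1 : gen a k.+2 = tnth a ip1. Proof. exact: (genS ip1). Qed.

Let subE (i j : 'I_k.+3) : (tnth a i <= tnth a j)%N ->
  (tnth a i)%:R - (tnth a j)%:R = - (tnth a j - tnth a i)%:R :> rat.
Proof. by move=> le_ij; rewrite natrB // opprB. Qed.

(** [gap] divides each consecutive difference, hence [dgcd], which is positive because a_2 > a_1.
    This lets [gap] replace d in the bound by S_i. *)
Lemma dgcd_ge_gap : ((gap k.+1 (tnth a))%:Z <= dgcd a)%R.
Proof.
have gap_dvd : ((gap k.+1 (tnth a))%:Z %| dgcd a)%Z.
  rewrite /dgcd big_nat.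
  apply: (big_ind (fun h => (gap k.+1 (tnth a))%:Z %| h)%Z) => [|x y hx hy|i iP].
  - exact: dvdz0.
  - by rewrite dvdz_gcd hx.
  have [lt1 lt2] : (i.-1 < k.+3)%N /\ (i < k.+3)%N by lia.
  have i_gt0 : (0 < i)%N by lia.
  have := genS (Ordinal lt2); have := genS (Ordinal lt1) => /=.
  rewrite prednK // => -> ->.
  have -> : (tnth a (Ordinal lt2))%:Z - (tnth a (Ordinal lt1))%:Z =
      (e (Ordinal lt2))%:Z - (e (Ordinal lt1))%:Z.
    by rewrite -!subzn //; ring.
  by rewrite rpredB // /dvdz /=; exact: gap_dvd_above.
have dgcd_gt0 : 0 < dgcd a.
  rewrite /dgcd big_ltn //= ltz_nat gcdn_gt0 absz_gt0 gen1 gen2 subr_eq0.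
  have := a_incr ord0 i2 isT; lia.
case: (dgcd a) dgcd_gt0 gap_dvd => // h h_gt0 /=.
by rewrite /dvdz /= => /dvdn_leq; apply.
Qed.

(** Since e_i + f_i = D, the entry f_i does not change the gcd of e_i and D. *)
Lemma gE (i : 'I_k.+3) : g a i.+1 = (gcdn (e i) D)%:Z.
Proof.
rewrite /g genS gen1 genp /gcdz /=; congr Posz.
rewrite -[(tnth a ord0)%:Z - _]opprB abszN !subzn //=.
apply/gcdn_idPl; rewrite -(dvdn_addr _ (dvdn_gcdl (e i) D)).
by rewrite -/(f i) (above_below _ _ a_min a_max i) dvdn_gcdr.
Qed.

Let DE (i : 'I_k.+3) : D = (q i * gcdn (e i) D)%N.
Proof. by rewrite divnK ?dvdn_gcdr. Qed.

Let g_gt0 (i : 'I_k.+3) : (0 < gcdn (e i) D)%N.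
Proof. by rewrite gcdn_gt0 (width_gt0 _ _ a_lt) orbT. Qed.

(** By D = q_i g_i, S_i equals a_2 ((p - 2) q_i e_i + d a_1) / e_2. *)
Lemma S_le (i : 'I_k.+3) (N : nat) : S_ a i.+1 <= N%:R ->
  (gen a 2 * (k.+1 * (q i * e i) + gap k.+1 (tnth a) * gen a 1) <= N * e i2)%N.
Proof.
have e2_gt0 : (0 < e i2)%N by rewrite subn_gt0 a_incr.
have -> : S_ a i.+1 = (gen a 2)%:R *
    (k.+1%:R * ((q i)%:R * (e i)%:R) + (dgcd a)%:~R * (gen a 1)%:R) / (e i2)%:R.
  rewrite /S_ gE genS gen1 gen2 genp !subE // -/(e i) -/(e i2) -/D.
  have -> : D%:R = (q i)%:R * (gcdn (e i) D)%:R :> rat by rewrite -natrM -DE.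
  rewrite -pmulrn.
  have g0 : (gcdn (e i) D)%:R != 0 :> rat by rewrite pnatr_eq0 -lt0n.
  have e20 : (e i2)%:R != 0 :> rat by rewrite pnatr_eq0 -lt0n.
  have -> : k.+3%:R - 2 = k.+1%:R :> rat by rewrite -addn2 natrD addrK.
  by field; rewrite g0 e20.
rewrite ler_pdivrMr ?ltr0n // => le_N.
rewrite -(ler_nat rat) !natrM; apply: le_trans le_N.
rewrite ler_wpM2l ?ler0n // natrD !natrM lerD2l ler_wpM2r ?ler0n //.
by rewrite pmulrn ler_int dgcd_ge_gap.
Qed.

(** Likewise S'_i equals a_{p-1} ((p - 2) q_i f_i + d a_p) / f_{p-1}, where d a_p >= 0 is dropped;
    [+ 0] fits the shape of [sum_le_average]. *)
Lemma S'_le (i : 'I_k.+3) (N : nat) : S'_ a i.+1 <= N%:R ->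
  (gen a k.+2 * (k.+1 * (q i * f i) + 0) <= N * f ip1)%N.
Proof.
have f_gt0 : (0 < f ip1)%N by rewrite subn_gt0 a_incr.
have -> : S'_ a i.+1 = (gen a k.+2)%:R *
    (k.+1%:R * ((q i)%:R * (f i)%:R) + (dgcd a)%:~R * (gen a k.+3)%:R) / (f ip1)%:R.
  rewrite /S'_ gE genS gen1 genp1 genp (subE _ _ (a_min ord_max)).
  rewrite (subE _ _ (a_max ip1)).
  rewrite -(natrB _ (a_max i)) -/(f ip1) -/(f i) -/D.
  have -> : D%:R = (q i)%:R * (gcdn (e i) D)%:R :> rat by rewrite -natrM -DE.
  rewrite -pmulrn.
  have g0 : (gcdn (e i) D)%:R != 0 :> rat by rewrite pnatr_eq0 -lt0n.
  have f0 : (f ip1)%:R != 0 :> rat by rewrite pnatr_eq0 -lt0n.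
  have -> : k.+3%:R - 2 = k.+1%:R :> rat by rewrite -addn2 natrD addrK.
  by field; rewrite g0 f0.
rewrite ler_pdivrMr ?ltr0n // addn0 => le_N.
rewrite -(ler_nat rat) !natrM; apply: le_trans le_N.
rewrite ler_wpM2l ?ler0n // lerDl mulr_ge0 ?ler0n //.
by rewrite ler0z; apply: le_trans dgcd_ge_gap.
Qed.

(** Averaging the bounds by S_i and S'_i gives [above_sum] and [below_sum]. The former yields the
    first bound of [large] through e_i >= e_2 and a_1 <= a_2, and the second through e_2 <= D; the
    latter yields the third through f_i >= f_{p-1}. *)
Lemma N0_large (n : nat) : N0 a <= n%:R -> large k.+1 (tnth a) (gen a k.+2) n.
Proof.
have a1_gt0 : (0 < gen a 1)%N by rewrite gen1.
rewrite /N0 ge_max => /andP[+ _]; rewrite ler_pdivrMr ?ltr0n // -natrM => NS_le.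
have S_N (i : 'I_k.+3) : (0 < i < k.+2)%N -> S_ a i.+1 <= (n * gen a 1)%:R.
  move=> iP; apply: le_trans NS_le; apply: le_trans (ceil_ge _).
  by rewrite le_max le_bigmax_seq ?mem_index_iota.
have S'_N (i : 'I_k.+3) : (0 < i < k.+2)%N -> S'_ a i.+1 <= (n * gen a 1)%:R.
  move=> iP; apply: le_trans NS_le; apply: le_trans (ceil_ge _).
  by rewrite le_max orbC le_bigmax_seq ?mem_index_iota.
have q0 := per_min _ _ a_lt; have qmax := per_max _ _ a_lt.
have ends (i : 'I_k.+3) : ~~ (0 < i < k.+2)%N -> i = ord0 \/ i = ord_max.
  move=> iP; have := ltn_ord i; case: (posnP i) => [i0|i_gt0] lt_i.
    by left; apply: val_inj.
  by right; apply: val_inj => /=; lia.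
have i2_in : (0 < i2 < k.+2)%N by [].
have above_sum :
    (gen a 2 * (\sum_i (q i).-1 * e i + gap k.+1 (tnth a) * gen a 1)
      <= n * gen a 1 * e i2)%N.
  apply: sum_le_average; rewrite ?q0 ?qmax // => i.
  have [iP|/ends i_end] := boolP (0 < i < k.+2)%N.
    apply: leq_trans (S_le _ _ (S_N _ iP)).
    by rewrite leq_mul2l leq_add2r !leq_mul2l leq_mul2r leq_pred !orbT.
  (* At an extreme index q_i - 1 = 0, so the bound at the second generator suffices. *)
  apply: leq_trans (S_le _ _ (S_N _ i2_in)).
  rewrite leq_mul2l leq_add2r; apply/orP; right.
  by case: i_end => ->; rewrite ?q0 ?qmax muln0.
have below_sum : (gen a k.+2 * (\sum_i (q i).-1 * f i + 0)
    <= n * gen a 1 * f ip1)%N.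
  apply: sum_le_average; rewrite ?q0 ?qmax // => i.
  have [iP|/ends i_end] := boolP (0 < i < k.+2)%N.
    apply: leq_trans (S'_le _ _ (S'_N _ iP)).
    by rewrite leq_mul2l leq_add2r !leq_mul2l leq_mul2r leq_pred !orbT.
  by case: i_end => ->; rewrite ?q0 ?qmax mul0n !muln0.
have le12 : (gen a 1 <= gen a 2)%N by rewrite gen1 gen2.
have a2_gt0 : (0 < gen a 2)%N by rewrite gen2.
have e2_gt0 : (0 < e i2)%N by rewrite subn_gt0 a_incr.
have f_gt0 : (0 < f ip1)%N by rewrite subn_gt0 a_incr.
split.
- rewrite -(leq_pmul2r e2_gt0) -(leq_pmul2l a2_gt0).
  apply: leq_trans (_ : n * gen a 1 * e i2 <= _)%N; last first.
    by rewrite mulnCA mulnA leq_mul2r leq_mul2l le12 !orbT.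
  apply: leq_trans above_sum; rewrite leq_mul2l; apply/orP; right.
  apply: leq_trans (leq_addr _ _); rewrite big_distrl; apply: leq_sum => i _ /=.
  have [i0|i_gt0] := posnP i.
    have -> : i = ord0 by apply: val_inj.
    by rewrite q0.
  by rewrite leq_mul2l leq_sub2r ?orbT // a_mono.
- rewrite -gen1 -(leq_pmul2l a2_gt0); apply: leq_trans above_sum _.
  by rewrite -mulnA [leqRHS]mulnCA leq_mul // leq_mul // leq_sub2r.
- rewrite -gen1 -(leq_pmul2r f_gt0); apply: leq_trans below_sum.
  rewrite addn0 mulnAC mulnC leq_mul2l; apply/orP; right.
  rewrite big_distrl; apply: leq_sum => i _ /=.
  have [->|i_max] := eqVneq i ord_max; first by rewrite qmax.
  rewrite leq_mul2l leq_sub2l ?orbT // a_mono //=.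
  have : val i != val (@ord_max k.+2) by rewrite val_eqE.
  by have := ltn_ord i; rewrite /=; lia.
Qed.

End ExplicitBound.

Theorem theorem11 (p : nat) (a : p.-tuple nat)
    (a_gt0 : forall i : 'I_p, (0 < tnth a i)%N)
    (a_incr : forall i j : 'I_p, (i < j)%N -> (tnth a i < tnth a j)%N)
    (a_prim : \big[gcdn/0%N]_(i < p) tnth a i = 1%N) :
  let delta := lcmn (gen a 1) (gen a p) in
  (exists n0 : nat, forall n : nat,
     (n0 <= n)%N -> Delta_nu a (n + delta) = Delta_nu a n) /\
  ((3 <= p)%N ->
   forall n : nat, N0 a <= n%:R -> Delta_nu a (n + delta) = Delta_nu a n).
Proof.
case: p a a_gt0 a_incr a_prim => [|[|p]] a a_gt0 a_incr a_prim delta.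
- by rewrite big_ord0 in a_prim.
- split=> //; exists 0%N => n _.
  (* With one generator the value determines the length, so every difference set is empty. *)
  have nu1 m l : nu a m l -> l = m.
    case=> s [_ [x xs <-]] [y ys <-]; have := etrans ys (esym xs).
    by rewrite /flength !big_ord1 => /eqP; rewrite eqn_pmul2l // => /eqP.
  have Delta1 m : Delta_nu a m = set0.
    apply/predeqP => j; split=> // -[l [l' [/nu1 -> /nu1 ->]]].
    by rewrite ltnn.
  by rewrite !Delta1.
have a_mono (i j : 'I_p.+2) : (i <= j)%N -> (tnth a i <= tnth a j)%N.
  rewrite leq_eqVlt => /orP[/eqP/val_inj -> //|lt_ij].
  exact: ltnW (a_incr _ _ lt_ij).
have a_min i : (tnth a ord0 <= tnth a i)%N by exact: a_mono.
have a_max i : (tnth a i <= tnth a ord_max)%N by apply: a_mono; rewrite -ltnS.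
have a_lt : (tnth a ord0 < tnth a ord_max)%N by exact: a_incr.
have gen1 : gen a 1 = tnth a ord0 by exact: (gen_tnth _ a ord0).
have genp : gen a p.+2 = tnth a ord_max by exact: (gen_tnth _ a ord_max).
pose b := gen a p.+1.
have bE : b = tnth a (widen_ord (leqnSn p.+1) ord_max).
  exact: (gen_tnth _ a (widen_ord (leqnSn p.+1) ord_max)).
have b_lt : (b < tnth a ord_max)%N by rewrite bE a_incr.
have b_max i : i != ord_max -> (tnth a i <= b)%N.
  move=> i_max; rewrite bE a_mono //=.
  have : val i != val (@ord_max p.+1) by rewrite val_eqE.
  by have := ltn_ord i; rewrite /=; lia.
have periodic n : large p (tnth a) b n -> Delta_nu a (n + delta) = Delta_nu a n.
  move=> n_large; rewrite /Delta_nu !nuE /delta gen1 genp.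
  set x := tnth a ord0; set y := tnth a ord_max.
  have uE : lcmn x y = (lcmn x y %/ x * x)%N by rewrite divnK // dvdn_lcml.
  have vE : lcmn x y = (lcmn x y %/ y * y)%N by rewrite divnK // dvdn_lcmr.
  rewrite uE.
  apply: (Delta_common_value_period _ _ _ _ _ b) (lcmn x y %/ y)%N _ _ => //.
    exact: gcdn_sub_coprime.
  by rewrite -uE.
split; last first.
  clear - a_gt0 a_incr periodic.
  case: p a a_gt0 a_incr @delta @b periodic => // k a a_gt0
    a_incr delta b periodic _ n nN.
  exact/periodic/N0_large.
set Q := (\sum_i (per p (tnth a) i).-1)%N.
set E := (\sum_i (per p (tnth a) i).-1 * above p (tnth a) i
  + gap p (tnth a) * tnth a ord0)%N.
(* Since D and a_1 are at least 1, this exceeds all three thresholds of [large], also for p = 2. *)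
exists (Q + E + Q * b)%N => n n_ge; apply: periodic; split.
- by rewrite -/Q; lia.
- rewrite -/E; apply: leq_trans (leq_pmulr _ (width_gt0 _ _ a_lt)); lia.
- by rewrite -/Q; apply: leq_trans (leq_pmulr _ (a_gt0 ord0)); lia.
Qed.
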